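(* Let $a\ge4$ be an integer. The subtraction game $\mathcal{S}(a,2a+2,3a+3)$ is ultimately periodic with period $4a+3$ and nim-sequence $2^{a-2}\,11\,00\,3^{a-4}\,22\,11\,0^{a-1}\,2\,1^{a-1}\,00$. When $a=4$ the subtraction set is non-expandable; otherwise the subtraction set has expansion $\{a,2a+2,3a+3\}\cup\{3a+4\}^{*(4a+3)}$.
   Context: For a finite set $S$ of positive integers, the subtraction game $\mathcal{S}(S)$ is played on a single pile: two players alternately remove $s\in S$ coins (at most the pile size); the last mover wins. The nim-value is $\mathcal{G}(n)=\operatorname{mex}\{\mathcal{G}(n-s): s\in S, s\le n\}$. Words of single digits are written by juxtaposition, and $x^m$ denotes $m$-fold repetition of the block $x$ ($x^0$ empty). ''The game is ultimately periodic with period $p$ and nim-sequence $W$'' ($W$ a word of length $p$) means $p$ is the least positive integer with $\mathcal{G}(n+p)=\mathcal{G}(n)$ for all sufficiently large $n$, and there is $n_0\ge0$ such that $\mathcal{G}(n_0+j)$ is the $((j\bmod p)+1)$-st letter of $W$ for all $j\ge0$. The expansion of $S$ is $S^{ex}=\{s\ge1:\mathcal{G}(n+s)\ne\mathcal{G}(n)\ \forall n\ge0\}$; ''has expansion $T$'' means $S^{ex}=T$. For a set $X$ and $p\ge1$, $X^{*p}=\{x+mp:x\in X,m\ge0\}$. $S$ is non-expandable if $S^{ex}=S$ or $S^{ex}=S^{*p}$, $p$ the period. *)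

(* Defs.v *)
From mathcomp Require Import all_boot.
From mathcomp Require Import classical_sets.

Set Implicit Arguments.
Unset Strict Implicit.
Unset Printing Implicit Defensive.

(* A finite set of positive integers is given by a list; only membership
   matters, not order or repetitions. *)

(* Some value below [(size vs).+1] is missing from [vs], so the search over
   [iota 0 (size vs).+1] succeeds; see [mexP]. *)
Definition mex (vs : seq nat) : nat :=
  find (fun v => v \notin vs) (iota 0 (size vs).+1).

Lemma mexP (vs : seq nat) :
  mex vs \notin vs /\ forall v, v < mex vs -> v \in vs.
Proof.
set P := fun v => v \notin vs; set t := iota 0 (size vs).+1.
have hasP' : has P t.
  apply/negPn/negP => /hasPn h.
  have sub : {subset t <= vs} by move=> v /h /negPn.
  by have := uniq_leq_size (iota_uniq _ _) sub; rewrite size_iota ltnn.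
have ltm : mex vs < (size vs).+1.
  by move: hasP'; rewrite has_find size_iota.
split; first by have := nth_find 0 hasP'; rewrite nth_iota.
move=> v ltv; have := before_find 0 ltv.
by rewrite nth_iota ?(ltn_trans ltv ltm)// => /negbFE.
Qed.

(* [nim_history S n] is the list of the nim-values of 0, ..., n-1; the
   defining recurrence of the nim-values is [nim_valueE]. *)
Fixpoint nim_history (S : seq nat) (n : nat) : seq nat :=
  if n is m.+1 then
    let h := nim_history S m in
    rcons h (mex [seq nth 0 h (m - s) | s <- S & s <= m])
  else [::].

Definition nim_value (S : seq nat) (n : nat) : nat :=
  nth 0 (nim_history S n.+1) n.

Lemma size_nim_history S n : size (nim_history S n) = n.
Proof. by elim: n => //= n IHn; rewrite size_rcons IHn. Qed.

Lemma nth_nim_history S n m :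
  m < n -> nth 0 (nim_history S n) m = nim_value S m.
Proof.
elim: n => // n IHn; rewrite ltnS leq_eqVlt => /orP[/eqP -> //|ltmn].
by rewrite [nim_history S n.+1]/= nth_rcons size_nim_history ltmn IHn.
Qed.

Lemma nim_valueE (S : seq nat) (n : nat) : all (leq 1) S ->
  nim_value S n = mex [seq nim_value S (n - s) | s <- S & s <= n].
Proof.
move=> /allP S_gt0; rewrite {1}/nim_value /= nth_rcons size_nim_history ltnn.
rewrite eqxx; congr mex; apply/eq_in_map => s.
rewrite mem_filter => /andP[lesn /S_gt0 s_gt0]; apply: nth_nim_history.
by rewrite -subn_gt0 subKn.
Qed.

Definition eventual_period (g : nat -> nat) (p : nat) : Prop :=
  0 < p /\ exists n0, forall n, n0 <= n -> g (n + p) = g n.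

Definition least_period (g : nat -> nat) (p : nat) : Prop :=
  eventual_period g p /\ forall q, eventual_period g q -> p <= q.

Definition ultimately_periodic (S : seq nat) (p : nat) (W : seq nat) : Prop :=
  [/\ least_period (nim_value S) p,
      size W = p
    & exists n0, forall j, nim_value S (n0 + j) = nth 0 W (j %% p)].

Definition expansion (S : seq nat) : set nat :=
  [set s | 1 <= s /\ forall n, nim_value S (n + s) <> nim_value S n]%classic.

Definition star (X : set nat) (p : nat) : set nat :=
  [set y | exists x m, X x /\ y = x + m * p]%classic.

Definition non_expandable (S : seq nat) : Prop :=
  expansion S = [set` S]%classic \/
  exists p, least_period (nim_value S) p /\
            expansion S = star [set` S]%classic p.

(* Main.v *)
(* Cut into rows of length p = 4a+3, the nim-sequence has two exceptional rows
   (0 and 1) and is constant from row 2 on, so the closed form is verified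
   against the mex recurrence by a finite case analysis with a as a parameter.
   In the periodic row, the only two zeros at cyclic distance a-2 are the ends
   1 and a-1 of the block 0^(a-1), so there is no shorter period.  A shift s
   outside the expansion already has G(n+s) = G(n) for one of the four values
   n = 0, p, p+a-1, p+3a+3. *)
From HB Require Import structures.
Require Import Defs.
From mathcomp Require Import all_boot.
From mathcomp Require Import classical_sets.
From mathcomp Require Import zify.

Lemma mex_unique (vs : seq nat) v :
  v \notin vs -> (forall w, w < v -> w \in vs) -> mex vs = v.
Proof.
have [mexN memlt] := mexP vs => vN ltv.
case: (ltngtP (mex vs) v) => // [/ltv|/memlt] h; first by rewrite h in mexN.
by rewrite h in vN.
Qed.

(** A move by [s] leads from [n + s] to [n], and a mex avoids the values of its options. So every
    element of [S] lies in the expansion. *)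
Lemma nim_value_option (S : seq nat) s n : all (leq 1) S -> s \in S ->
  nim_value S (n + s) <> nim_value S n.
Proof.
move=> S_gt0 sS eqn; have [/negP mexN _] :=
  mexP [seq nim_value S (n + s - t) | t <- S & t <= n + s].
apply: mexN; rewrite -nim_valueE // eqn; apply/mapP; exists s; last by rewrite addnK.
by rewrite mem_filter leq_addl.
Qed.

(* The nim-sequence of S(a, 2a+2, 3a+3), cut into rows of length 4a+3:
   [nim_row a k i] is the nim-value of [k * (4 * a + 3) + i].  All rows from
   row 2 on agree.  Locked, because conversion otherwise evaluates the tests. *)
HB.lock Definition nim_row (a k i : nat) : nat :=
  if i == 0 then match k with 0 => 0 | 1 => 2 | _ => 1 end
  else if i < a then 0
  else if i == a then match k with 0 => 1 | 1 => 3 | _ => 2 end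
  else if i < 2 * a then 1
  else if i < 2 * a + 2 then 0
  else if i == 2 * a + 2 then match k with 1 => 3 | _ => 2 end
  else if i < 3 * a then 2
  else if i < 3 * a + 2 then 1
  else if i == 3 * a + 2 then 0
  else if i == 3 * a + 3 then match k with 0 => 3 | _ => 0 end
  else if i < 4 * a then 3
  else if i < 4 * a + 2 then 2
  else 1.

(** Each contradictory branch is closed as soon as it opens, so the case tree stays near the number
    of feasible block combinations. *)
Ltac split_ifs :=
  lazymatch goal with
  | |- context [if ?b then _ else _] =>
     let E := fresh "E" in case E : b; first [exfalso; lia | split_ifs]
  | _ => lia
  end.

Ltac row_cases := rewrite ?nim_row.unlock; cbv beta iota; split_ifs.

Lemma nim_row_stable a k i : 2 <= k -> nim_row a k i = nim_row a 2 i.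
Proof. by rewrite nim_row.unlock; case: k => [//|[//|k] _]. Qed.

(** Every [s] is below the row length, so a move crosses at most one row boundary. *)
Lemma nim_row_option a k i s : 4 <= a -> i < 4 * a + 3 ->
  s \in [:: a; 2 * a + 2; 3 * a + 3] ->
  nim_row a k i <>
   if i + s < 4 * a + 3 then nim_row a k (i + s)
   else nim_row a k.+1 (i + s - (4 * a + 3)).
Proof.
move=> ha hi; rewrite !inE => /or3P[] /eqP -> {s}; case: k => [|[|k]].
all: row_cases.
Qed.

Lemma nim_row_reach a k i w : 4 <= a -> i < 4 * a + 3 -> w < nim_row a k i ->
  has (fun s => if s <= i then nim_row a k (i - s) == w
                else (0 < k) && (nim_row a k.-1 (i + (4 * a + 3) - s) == w))
    [:: a; 2 * a + 2; 3 * a + 3].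
Proof.
move=> ha hi; rewrite /has; case: k => [|[|k]]; rewrite {1}nim_row.unlock; cbv beta iota.
all: repeat match goal with
  | |- is_true (_ < if ?b then _ else _) -> _ =>
     let E := fresh "E" in case E : b; try (exfalso; lia)
  end.
(* Nim-values are at most 3, so only [w] = 0, 1, 2 remain; for each, one of the three moves is tried
   in turn. *)
all: case: w => [|[|[|w]]] lew; try (exfalso; lia).
all: apply/or4P; rewrite nim_row.unlock ?succnK; cbv beta iota.
all: first [constructor 1; split_ifs | constructor 2; split_ifs | constructor 3; split_ifs].
Qed.

(** Here [k' - k] counts the full rows in the shift. For [a = 4] the block of 3s is empty and
    position [3 * a + 4] carries 2, the value at the start of row 1, so the claim fails. *)
Lemma nim_row_expansion a k k' i : 5 <= a -> i < 4 * a + 3 -> k <= k' ->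
  (if i + (3 * a + 4) < 4 * a + 3 then nim_row a k' (i + (3 * a + 4))
   else nim_row a k'.+1 (i + (3 * a + 4) - (4 * a + 3))) <> nim_row a k i.
Proof.
move=> ha hi; case: k => [|[|k]]; case: k' => [|[|k']] //= lek.
all: row_cases.
Qed.

(** For [m >= 2], the first two tests, with values 0 and 2, leave only [r] carrying 1 or 3. The
    other two test points are zeros and remove all of these except [3 * a + 4]. *)
Lemma nim_row_not_expansion a m r : 4 <= a -> r < 4 * a + 3 -> 0 < m + r ->
  let shifted k i :=
    if i + r < 4 * a + 3 then nim_row a (k + m) (i + r)
    else nim_row a (k + m).+1 (i + r - (4 * a + 3)) in
  shifted 0 0 <> nim_row a 0 0 -> shifted 1 0 <> nim_row a 1 0 ->
  shifted 1 (a - 1) <> nim_row a 1 (a - 1) ->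
  shifted 1 (3 * a + 3) <> nim_row a 1 (3 * a + 3) ->
  (m == 0) && (r \in [:: a; 2 * a + 2; 3 * a + 3]) || (r == 3 * a + 4) && (a != 4).
Proof.
move=> ha hr mr; rewrite !inE; case: m mr => [|[|m]] mr shifted;
  rewrite {}/shifted !(add0n, add1n).
all: row_cases.
Qed.

(** The word is the periodic row read cyclically from position [2 * a + 2]. *)
Lemma nth_nim_word a r : 4 <= a -> r < 4 * a + 3 ->
  nth 0 (nseq (a - 2) 2 ++ [:: 1; 1] ++ [:: 0; 0] ++ nseq (a - 4) 3
             ++ [:: 2; 2] ++ [:: 1; 1] ++ nseq (a - 1) 0 ++ [:: 2]
             ++ nseq (a - 1) 1 ++ [:: 0; 0]) r =
  if 2 * a + 2 + r < 4 * a + 3 then nim_row a 2 (2 * a + 2 + r)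
  else nim_row a 2 (2 * a + 2 + r - (4 * a + 3)).
Proof.
move=> ha hr; rewrite -![[:: 1; 1]]/(nseq 2 1) -[[:: 2; 2]]/(nseq 2 2).
rewrite -![[:: 0; 0]]/(nseq 2 0) -[[:: 2]]/(nseq 1 2).
rewrite !(nth_cat, size_nseq, nth_nseq).
row_cases.
Qed.

Definition nim_formula (a n : nat) : nat :=
  nim_row a (n %/ (4 * a + 3)) (n %% (4 * a + 3)).

Lemma nim_formula_row a k i : i < 4 * a + 3 ->
  nim_formula a (k * (4 * a + 3) + i) = nim_row a k i.
Proof.
move=> hi; have p_gt0 : 0 < 4 * a + 3 by lia.
by rewrite /nim_formula divnMDl // modnMDl divn_small // modn_small // addn0.
Qed.

Lemma nim_formula_add a k i m r : i < 4 * a + 3 -> r < 4 * a + 3 ->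
  nim_formula a (k * (4 * a + 3) + i + (m * (4 * a + 3) + r)) =
  if i + r < 4 * a + 3 then nim_row a (k + m) (i + r)
  else nim_row a (k + m).+1 (i + r - (4 * a + 3)).
Proof.
move=> hi hr; case: ifP => h.
  by rewrite addnACA -mulnDl nim_formula_row.
rewrite addnACA -mulnDl -nim_formula_row; last by lia.
by congr nim_formula; lia.
Qed.

Lemma nim_value_formula a n : 4 <= a ->
  nim_value [:: a; 2 * a + 2; 3 * a + 3] n = nim_formula a n.
Proof.
move=> ha; have S_gt0 : all (leq 1) [:: a; 2 * a + 2; 3 * a + 3] by rewrite /=; lia.
have S_lt s : s \in [:: a; 2 * a + 2; 3 * a + 3] -> 0 < s < 4 * a + 3.
  by rewrite !inE; lia.
elim/ltn_ind: n => n IHn; rewrite nim_valueE //.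
have -> : [seq nim_value [:: a; 2 * a + 2; 3 * a + 3] (n - s)
            | s <- [:: a; 2 * a + 2; 3 * a + 3] & s <= n] =
          [seq nim_formula a (n - s) | s <- [:: a; 2 * a + 2; 3 * a + 3] & s <= n].
  apply/eq_in_map => s; rewrite mem_filter => /andP[les /S_lt s_gt0].
  by apply: IHn; lia.
apply: mex_unique.
  apply/mapP => -[s]; rewrite mem_filter => /andP[les sS].
  have /andP[_ lts] := S_lt s sS; have ltp : (n - s) %% (4 * a + 3) < 4 * a + 3.
    by rewrite ltn_mod; lia.
  (* The row lemma compares a position with a later one, so it is applied at [n - s]. *)
  have := nim_row_option a ((n - s) %/ (4 * a + 3)) _ s ha ltp sS.
  have := nim_formula_add a ((n - s) %/ (4 * a + 3)) _ 0 s ltp lts.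
  rewrite -divn_eq mul0n add0n addn0 subnK // => -> neq eqn.
  by apply: neq; rewrite eqn.
have ltp : n %% (4 * a + 3) < 4 * a + 3 by rewrite ltn_mod; lia.
move=> w /(nim_row_reach _ _ _ _ ha ltp) /hasP[s sS].
move=> hit; rewrite /= in hit; have /andP[_ lts] := S_lt s sS; have := divn_eq n (4 * a + 3).
move: (n %/ _) (n %% _) ltp hit => k i ltp hit defn; subst n; clear IHn.
case: (leqP s i) hit => [les /eqP <-|lti /andP[k_gt0 /eqP <-]]; apply/mapP; exists s.
- by rewrite mem_filter sS andbT; lia.
- by rewrite -addnBA // nim_formula_row //; lia.
- by rewrite mem_filter sS andbT; case: k k_gt0 => // k _; lia.
- case: k k_gt0 => // k _; rewrite succnK -nim_formula_row; last by lia.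
  by congr nim_formula; lia.
Qed.

(** Serves both cases of the theorem: the second alternative is void for [a = 4]. *)
Lemma expansionE a s : 4 <= a ->
  expansion [:: a; 2 * a + 2; 3 * a + 3] s <->
  s \in [:: a; 2 * a + 2; 3 * a + 3] \/
  a <> 4 /\ exists m, s = 3 * a + 4 + m * (4 * a + 3).
Proof.
move=> ha; have p_gt0 : 0 < 4 * a + 3 by lia.
split=> [[s_gt0 exps]|[sS|[a_neq4 [m ->]]]].
- have ltr : s %% (4 * a + 3) < 4 * a + 3 by rewrite ltn_mod.
  have exps' k i : i < 4 * a + 3 ->
      (if i + s %% (4 * a + 3) < 4 * a + 3
       then nim_row a (k + s %/ (4 * a + 3)) (i + s %% (4 * a + 3))
       else nim_row a (k + s %/ (4 * a + 3)).+1
              (i + s %% (4 * a + 3) - (4 * a + 3))) <> nim_row a k i.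
    move=> hi; rewrite -nim_formula_add // -nim_formula_row // -divn_eq.
    by rewrite -!nim_value_formula.
  have mr_gt0 : 0 < s %/ (4 * a + 3) + s %% (4 * a + 3).
    by rewrite lt0n addn_eq0; apply/negP => /andP[/eqP m0 /eqP r0];
       move: s_gt0; rewrite (divn_eq s (4 * a + 3)) m0 r0.
  have := nim_row_not_expansion a _ _ ha ltr mr_gt0.
  move=> /(_ (exps' _ _ _) (exps' _ _ _) (exps' _ _ _) (exps' _ _ _)).
  case/(_ _ _ _ _)/orP; try lia.
    by case/andP=> /eqP m0 rS; left; rewrite (divn_eq s (4 * a + 3)) m0.
  case/andP=> /eqP r /eqP a4; right; split=> //; exists (s %/ (4 * a + 3)).
  by rewrite -r addnC -divn_eq.
- have S_gt0 : all (leq 1) [:: a; 2 * a + 2; 3 * a + 3] by rewrite /=; lia.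
  by split=> [|n]; [exact: (allP S_gt0) | exact: nim_value_option].
- split=> [|n]; first by lia.
  rewrite !nim_value_formula // [3 * a + 4 + _]addnC [in n + _](divn_eq n (4 * a + 3)).
  rewrite nim_formula_add ?ltn_mod //; last by lia.
  by apply: nim_row_expansion; rewrite ?ltn_mod ?leq_addr //; lia.
Qed.

Lemma nim_value_least_period a : 4 <= a ->
  least_period (nim_value [:: a; 2 * a + 2; 3 * a + 3]) (4 * a + 3).
Proof.
move=> ha; have p_gt0 : 0 < 4 * a + 3 by lia.
split=> [|q [q_gt0 [n0 perq]]].
  split=> //; exists (2 * (4 * a + 3)) => n len.
  rewrite !nim_value_formula // /nim_formula divnDr // divnn p_gt0 modnDr.
  rewrite nim_row_stable ?(nim_row_stable a (n %/ _)) //.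
    by rewrite leq_divRL.
  by rewrite addn1 ltnS (leq_trans (isT : 1 <= 2)) // leq_divRL.
rewrite leqNgt; apply/negP => ltq.
(* Row [n0 + 2] starts beyond [n0] and is stable, so the eventual period acts cyclically on row
   2. *)
have perq' i : i < 4 * a + 3 ->
    (if i + q < 4 * a + 3 then nim_row a 2 (i + q)
     else nim_row a 2 (i + q - (4 * a + 3))) = nim_row a 2 i.
  move=> hi; have := perq ((n0 + 2) * (4 * a + 3) + i).
  have := nim_formula_add a (n0 + 2) _ 0 _ hi ltq; rewrite mul0n add0n addn0 => addq.
  rewrite !nim_value_formula // addq nim_formula_row //.
  rewrite !(nim_row_stable a (n0 + 2)) ?(nim_row_stable a (n0 + 2).+1); lia.
(* The zeros at 1 and [a - 1] would move to another pair of zeros at the same cyclic distance. *)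
move: (perq' 1) (perq' (a - 1)); row_cases.
Qed.

Theorem theorem6p3 (a : nat) (ha : 4 <= a) :
  let S := [:: a; 2 * a + 2; 3 * a + 3] in
  let W := nseq (a - 2) 2 ++ [:: 1; 1] ++ [:: 0; 0] ++ nseq (a - 4) 3
             ++ [:: 2; 2] ++ [:: 1; 1] ++ nseq (a - 1) 0 ++ [:: 2]
             ++ nseq (a - 1) 1 ++ [:: 0; 0] in
  [/\ ultimately_periodic S (4 * a + 3) W,
      a = 4 -> non_expandable S
    & a <> 4 ->
      expansion S =
        ([set` S] `|` star [set 3 * a + 4] (4 * a + 3))%classic].
Proof.
move=> S W; split.
- split; first exact: nim_value_least_period.
    by rewrite /W !size_cat !size_nseq /=; lia.
  (* Row 2 is the first stable row, and the word starts at its position [2 * a + 2]. *)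
  exists (2 * (4 * a + 3) + (2 * a + 2)) => j; rewrite /S /W nim_value_formula //.
  have ltr : j %% (4 * a + 3) < 4 * a + 3 by rewrite ltn_mod; lia.
  rewrite nth_nim_word // {1}(divn_eq j (4 * a + 3)) nim_formula_add //; last by lia.
  by rewrite !(nim_row_stable a (2 + _)) // (nim_row_stable a (2 + _).+1).
- move=> a4; left; apply/seteqP; split=> s /=; first by case/expansionE=> // -[].
  by move=> sS; apply/expansionE; [|left].
- move=> a4; apply/seteqP; split=> s /=.
    case/expansionE=> // [sS|[_ [m ->]]]; first by left.
    by right; exists (3 * a + 4), m.
  case=> [sS|[_ [m [-> ->]]]]; apply/expansionE => //; first by left.
  by right; split=> //; exists m.
Qed.
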